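(* Let $A^*$ be an infinite set. Then there exist a homogeneous family $\mathcal F^*\subseteq\mathcal P(A^* )$ and a subset $A\subseteq A^*$ with $|A|=|A^*|$ such that $$\mathcal P(A)=\{X\cap A: X\in\mathcal F^*\}\quad\text{and}\quad \mathrm{Sym}(A)\subseteq\{g\restriction A: g\in \mathrm{Aut}(\mathcal F^* )\}.$$ Consequently, any injection $f:A^*\to A$ induces a bi-embedding of every family $\mathcal F\subseteq\mathcal P(A^* )$ (not necessarily homogeneous) into $\mathcal F^*$. In particular, $\mathcal F^*$ is bi-universal in the class of all homogeneous families over $A^*$: every homogeneous family $\mathcal F\subseteq \mathcal P(A^* )$ bi-embeds into $\mathcal F^*$.
   Context: For a set $A$ and $\mathcal F\subseteq\mathcal P(A)$, an automorphism of $\mathcal F$ is a permutation $\sigma\in\mathrm{Sym}(A)$ such that for every $X\subseteq A$, $X\in\mathcal F\iff\sigma[X]\in\mathcal F$; $\mathrm{Aut}(\mathcal F)$ is the group of all automorphisms. A demand on $\mathcal F$ is a pair $d=(h^d,f^d)$ where $h^d$ is a finite injective partial function from $A$ to $A$, $f^d$ is a finite injective partial function from $\mathcal F$ to $\mathcal F$, and $x\in X\iff h^d(x)\in f^d(X)$ for all $x\in\mathrm{dom}\,h^d$, $X\in\mathrm{dom}\,f^d$. An automorphism $g$ satisfies $d$ if $g(x)=h^d(x)$ for $x\in\mathrm{dom}\,h^d$ and $g[X]=f^d(X)$ for $X\in\mathrm{dom}\,f^d$. $\mathcal F$ is homogeneous if every demand on $\mathcal F$ is satisfied by some automorphism of $\mathcal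 F$. A family $\mathcal F\subseteq \mathcal P(B)$ is viewed as the bipartite incidence structure $(B,\mathcal F,\in)$. An embedding of $\mathcal F\subseteq\mathcal P(B)$ into $\mathcal F'\subseteq\mathcal P(B')$ is an injection $f:B\to B'$ together with an injection $X\mapsto X'$ from $\mathcal F$ to $\mathcal F'$ such that $x\in X\iff f(x)\in X'$ (equivalently $f[X]=X'\cap \mathrm{ran} f$); the family embedding is said to be induced by $f$. An embedding is a bi-embedding if for every automorphism $g$ of $\mathcal F$ there is an automorphism $g'$ of $\mathcal F'$ with $g'(f(x))=f(g(x))$ for all $x\in B$ (and hence $g'$ carries $X'$ to $(g[X])'$ on $\mathrm{ran} f$). A family is bi-universal in a class if every member of the class bi-embeds into it. *)

(* Defs.v *)
From mathcomp Require Import all_boot.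
From mathcomp Require Import boolp classical_sets functions cardinality.

Set Implicit Arguments.
Unset Strict Implicit.
Unset Printing Implicit Defensive.

Local Open Scope classical_set_scope.

(* A base set is a type [T], and a family of subsets of it is an element of   *)
(* [set (set T)].  A map defined only on a subset [D] of [T] is a total       *)
(* function whose values outside [D] are irrelevant.                          *)

(* Permutations of a subset [A]. *)
Definition Sym (T : Type) (A : set T) : set (T -> T) :=
  [set s | set_bij A A s].

Definition Aut (T : Type) (F : set (set T)) : set (T -> T) :=
  [set s | Sym [set: T] s /\ forall X : set T, F X <-> F (s @` X)].

(* [demand_h] and [demand_f] are the finite partial functions on points and   *)
(* on members of the family, with domains [demand_hdom] and [demand_fdom].    *)
Record demand (T : Type) (F : set (set T)) := Demand {
  demand_hdom : set T;
  demand_h : T -> T;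
  demand_fdom : set (set T);
  demand_f : set T -> set T;
  demand_hfin : finite_set demand_hdom;
  demand_hinj : set_inj demand_hdom demand_h;
  demand_ffin : finite_set demand_fdom;
  demand_fdom_sub : demand_fdom `<=` F;
  demand_ffun : set_fun demand_fdom F demand_f;
  demand_finj : set_inj demand_fdom demand_f;
  demand_compat : forall (x : T) (X : set T),
    demand_hdom x -> demand_fdom X -> (X x <-> demand_f X (demand_h x))
}.

Definition satisfies (T : Type) (F : set (set T)) (g : T -> T)
    (d : demand F) : Prop :=
  (forall x, demand_hdom d x -> g x = demand_h d x) /\
  (forall X, demand_fdom d X -> g @` X = demand_f d X).

Definition homogeneous (T : Type) (F : set (set T)) : Prop :=
  forall d : demand F, exists2 g, Aut F g & satisfies g d.

Definition embedding (B B' : Type) (F : set (set B)) (F' : set (set B'))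
    (f : B -> B') (phi : set B -> set B') : Prop :=
  [/\ injective f, set_fun F F' phi, set_inj F phi
    & forall (x : B) (X : set B), F X -> (X x <-> phi X (f x))].

Definition bi_embedding (B B' : Type) (F : set (set B)) (F' : set (set B'))
    (f : B -> B') (phi : set B -> set B') : Prop :=
  embedding F F' f phi /\
  (forall g, Aut F g -> exists2 g', Aut F' g' & forall x, g' (f x) = f (g x)).

Definition induces_bi_embedding (B B' : Type) (F : set (set B))
    (F' : set (set B')) (f : B -> B') : Prop :=
  exists phi : set B -> set B', bi_embedding F F' f phi.

Definition bi_embeds (B B' : Type) (F : set (set B)) (F' : set (set B')) :
    Prop :=
  exists f : B -> B', induces_bi_embedding F F' f.

(* [C] is a class of families over a fixed base set [B]. *)
Definition bi_universal (B B' : Type) (C : set (set (set B)))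
    (F' : set (set B')) : Prop :=
  forall F : set (set B), C F -> bi_embeds F F'.

(* Main.v *)
Require Import Defs.
From mathcomp Require Import all_boot.
From mathcomp Require Import boolp classical_sets functions cardinality.

Set Implicit Arguments.
Unset Strict Implicit.
Unset Printing Implicit Defensive.

Local Open Scope classical_set_scope.
Local Open Scope card_scope.

(* The family is the union of a tower of incidence structures, in the spirit   *)
(* of Hrushovski's extension property.  The sets of a structure [M] form a     *)
(* Cantor cube [idx -> bool], and membership of a point is a clopen (i.e.      *)
(* polynomial) condition on the cube.  A point of the next structure is a pair *)
(* [(x, u)] with [u] clopen on the cube of [M], a set is a pair [(y, xi)] with *)
(* [xi] any subset of the points of [M], and [(x, u)] belongs to [(y, xi)] iff *)
(* [u y (+) xi x].  One embeds [M] by [x |-> (x, 0)] and [y |-> (y, y)].       *)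
(* Automorphisms of [M] lift canonically.  Since homeomorphisms of a cube      *)
(* realise every finite injection, a finite demand on [M] is realised on each  *)
(* sort separately, and the failure of compatibility between the two sorts is, *)
(* for every [x], a clopen function of [y], which the component [u] absorbs.   *)
(* Hence every finite demand on [M] is satisfied by an automorphism of the     *)
(* next structure, and the limit is homogeneous.  The tower starts from all    *)
(* subsets of [T], where all permutations act, and this gives [A].  There are  *)
(* as many clopen functions as points, so by Hessenberg's theorem the limit    *)
(* has as many points as [T].                                                  *)

(** * Hessenberg's theorem *)

(** A stage need not be homogeneous, but [partial_aut_extends] meets each finite demand on it one
    level higher, and [aut_extends] lifts the resulting automorphism through all later levels to the
    limit. A finite demand on the limit lives on one level, whence [universal_family_homogeneous].
    The set [A] consists of the points of level zero, where every subset is present and every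
    permutation acts ([perm_aut]); [bi_embedding_of_rich] derives the bi-embeddings from these two
    properties. By [infinite_square_embeds] and [direct_limit], [T] itself can serve as the point
    set of the limit. *)

Definition embeds (X T : Type) : Prop := exists f : X -> T, injective f.

Lemma embeds_trans (X Y Z : Type) : embeds X Y -> embeds Y Z -> embeds X Z.
Proof. by move=> [f fI] [g gI]; exists (g \o f); exact: inj_comp. Qed.

Definition set_embeds (T : Type) (A B : set T) : Prop :=
  exists f : T -> T, (forall x, A x -> B (f x)) /\
    (forall x y, A x -> A y -> f x = f y -> x = y).

(** A maximal partial injection between [A] and [B], obtained as a graph by Zorn's lemma, exhausts
    [A] or [B]: otherwise one more pair could be added. *)
Lemma set_embeds_total (T : Type) (A B : set T) :
  set_embeds A B \/ set_embeds B A.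
Proof.
pose P (G : set (T * T)) := [/\ forall x y, G (x, y) -> A x /\ B y,
  forall x y y', G (x, y) -> G (x, y') -> y = y' &
  forall x x' y, G (x, y) -> G (x', y) -> x = x'].
have [F FP Ftot|G [[Gsub Gfun Ginj] Gmax]] := @Zorn_bigcup _ P.
  have two p q : (\bigcup_(X in F) X) p -> (\bigcup_(X in F) X) q ->
      exists X, [/\ P X, X p & X q].
    move=> [X FX Xp] [Y FY Yq].
    by have [XY|YX] := Ftot _ _ FX FY;
      [exists Y|exists X]; split=> //; [exact: FP|exact: XY|exact: FP|exact: YX].
  split=> [x y Gxy|x y y' Gxy Gxy'|x x' y Gxy Gxy'].
  - by have [X [[Xsub _ _] Xxy _]] := two _ _ Gxy Gxy; exact: Xsub.
  - by have [X [[_ Xfun _] Xxy]] := two _ _ Gxy Gxy'; exact: Xfun.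
  - by have [X [[_ _ Xinj] Xxy]] := two _ _ Gxy Gxy'; exact: Xinj.
have [domG|/existsNP[a /not_implyP[Aa aG]]] :=
    pselect (forall x, A x -> exists y, G (x, y)).
  have /choice[f fP] x : exists y, A x -> G (x, y).
    by have [/domG[y Gxy]|nAx] := pselect (A x); [exists y|exists x => /nAx].
  left; exists f; split=> [x /fP/Gsub[]//|x y /fP Gx /fP Gy fxy].
  by apply: Ginj Gx _; rewrite fxy.
have [codG|/existsNP[b /not_implyP[Bb bG]]] :=
  pselect (forall y, B y -> exists x, G (x, y)).
  have /choice[f fP] y : exists x, B y -> G (x, y).
    by have [/codG[x Gxy]|nBy] := pselect (B y); [exists x|exists y => /nBy].
  right; exists f; split=> [y /fP/Gsub[]//|x y /fP Gx /fP Gy fxy].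
  by apply: Gfun Gx _; rewrite fxy.
exfalso; apply: (Gmax ((a, b) |` G)).
  split; first by move=> p; right.
  by move=> /(_ (a, b) (or_introl erefl)) Gab; apply: aG; exists b.
split=> [x y [[-> ->]//|/Gsub//]|x y y'|x x' y].
- move=> [[xa ->]|Gxy] [[xa' ->]|Gxy'] //.
  + by case: aG; exists y'; rewrite -xa.
  + by case: aG; exists y; rewrite -xa'.
  + exact: Gfun Gxy Gxy'.
- move=> [[-> yb]|Gxy] [[-> yb']|Gxy'] //.
  + by case: bG; exists x'; rewrite -yb.
  + by case: bG; exists x; rewrite -yb'.
  + exact: Ginj Gxy Gxy'.
Qed.

(* [square_graph G] says that [G] is the graph of an injection of [D * D] into *)
(* [D], where [D] is read off from the diagonal of [G].                        *)
Definition diag_dom (T : Type) (G : set (T * T * T)) : set T :=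
  [set x | exists z, G (x, x, z)].

Definition square_graph (T : Type) (G : set (T * T * T)) : Prop :=
  [/\ forall x y, diag_dom G x -> diag_dom G y ->
        exists2 z, diag_dom G z & G (x, y, z),
      forall x y z, G (x, y, z) -> diag_dom G x /\ diag_dom G y,
      forall x y z z', G (x, y, z) -> G (x, y, z') -> z = z' &
      forall x y x' y' z, G (x, y, z) -> G (x', y', z) -> x = x' /\ y = y'].

(** Each condition involves at most two triples, which lie in [G0] together with one member of the
    chain. Adjoining [G0] takes care of the empty chain. *)
Lemma square_graph_chain (T : Type) (G0 : set (T * T * T))
    (F : set (set (T * T * T))) :
  square_graph G0 -> (forall G, F G -> square_graph (G0 `|` G)) ->
  total_on F subset -> square_graph (G0 `|` \bigcup_(G in F) G).
Proof.
move=> sG0 sF Ftot; set U := G0 `|` _.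
have two p q : U p -> U q -> exists H, [/\ square_graph H, H `<=` U, H p & H q].
  have FU G : F G -> G0 `|` G `<=` U.
    by move=> FG r [?|?]; [left|right; exists G].
  move=> [p0|[X FX Xp]] [q0|[Y FY Yq]].
  - by exists G0; split=> // r; left.
  - by exists (G0 `|` Y); split; [exact: sF|exact: FU|left|right].
  - by exists (G0 `|` X); split; [exact: sF|exact: FU|right|left].
  - have [XY|YX] := Ftot _ _ FX FY.
      by exists (G0 `|` Y); split; [exact: sF|exact: FU|right; exact: XY|right].
    by exists (G0 `|` X); split; [exact: sF|exact: FU|right|right; exact: YX].
have domU H : H `<=` U -> diag_dom H `<=` diag_dom U.
  by move=> HU x [z Hz]; exists z; exact: HU.
split.
- move=> x y [u Ux] [v Uy]; have [H [[Htot _ _ _] HU Hx Hy]] := two _ _ Ux Uy.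
  have [||z Dz Hz] := Htot x y; [by exists u|by exists v|].
  by exists z; [exact: domU Dz|exact: HU].
- move=> x y z Uxy; have [H [[_ Hdom _ _] HU Hxy _]] := two _ _ Uxy Uxy.
  by have [Dx Dy] := Hdom _ _ _ Hxy; split; exact: domU HU _ _.
- move=> x y z z' Uz Uz'; have [H [[_ _ Hfun _] _ Hz Hz']] := two _ _ Uz Uz'.
  exact: Hfun Hz Hz'.
- move=> x y x' y' z Uz Uz'; have [H [[_ _ _ Hinj] _ Hz Hz']] := two _ _ Uz Uz'.
  exact: Hinj Hz Hz'.
Qed.

Lemma square_graph_fun (T : Type) (G : set (T * T * T)) : square_graph G ->
  exists f : T * T -> T,
    (forall x y, diag_dom G x -> diag_dom G y -> diag_dom G (f (x, y))) /\
    (forall x y x' y', diag_dom G x -> diag_dom G y ->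
       diag_dom G x' -> diag_dom G y' ->
       f (x, y) = f (x', y') -> x = x' /\ y = y').
Proof.
set X := diag_dom G => -[Gtot Gdom Gfun Ginj].
have /choice[f fP] (p : T * T) :
    exists z, X p.1 -> X p.2 -> X z /\ G (p.1, p.2, z).
  have [[X1 X2]|nX] := pselect (X p.1 /\ X p.2); last first.
    by exists p.1 => X1 X2; case: nX.
  by have [z Xz Gz] := Gtot _ _ X1 X2; exists z.
exists f; split=> [x y Xx Xy|x y x' y' Xx Xy Xx' Xy' ff]; first by case: (fP (x, y)).
have [_ G1] := fP (x, y) Xx Xy; have [_ G2] := fP (x', y') Xx' Xy'.
by apply: Ginj G1 _; rewrite ff.
Qed.

(** The domain [X] grows by a disjoint copy, its image under [phi]. The enlarged set injects into
    [X] by tagging its halves with [c] and [c'], so a new pair can be coded in [X] and the code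
    pushed by [phi] into the copy, where it meets no old value. *)
Lemma square_graph_extend (T : Type) (G : set (T * T * T)) (c c' : T) :
  square_graph G -> diag_dom G c -> diag_dom G c' -> c <> c' ->
  set_embeds (diag_dom G) (~` diag_dom G) ->
  exists2 G', square_graph G' & G `<` G'.
Proof.
move=> sG; set X := diag_dom G; have [Gtot Gdom Gfun Ginj] := sG.
move=> Xc Xc' cc' [phi [phiN phi_inj]].
have [f [fX fI]] := square_graph_fun sG.
pose X2 := X `|` phi @` X.
have /choice[rho rhoP] x : exists r, X2 x -> X r /\
    ((X x /\ r = f (c, x)) \/ exists2 u, X u & x = phi u /\ r = f (c', u)).
  have [[Xx|[u Xu <-]]|nX] := pselect (X2 x).
  - by exists (f (c, x)) => _; split; [exact: fX|left].
  - by exists (f (c', u)) => _; split; [exact: fX|right; exists u].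
  - by exists x.
have rhoX x : X2 x -> X (rho x) by case/rhoP.
have rho_inj x y : X2 x -> X2 y -> rho x = rho y -> x = y.
  move=> /rhoP[_ Hx] /rhoP[_ Hy] rxy.
  case: Hx => [[Xx rx]|[u Xu [xE rx]]]; case: Hy => [[Xy ry]|[v Xv [yE ry]]].
  - by have := fI _ _ _ _ Xc Xx Xc Xy; rewrite -rx -ry => /(_ rxy)[].
  - by have := fI _ _ _ _ Xc Xx Xc' Xv; rewrite -rx -ry => /(_ rxy)[].
  - by have := fI _ _ _ _ Xc' Xu Xc Xy; rewrite -rx -ry => /(_ rxy)[/esym].
  - have := fI _ _ _ _ Xc' Xu Xc' Xv; rewrite -rx -ry => /(_ rxy)[_ uv].
    by rewrite xE yE uv.
pose new x y := phi (f (rho x, rho y)).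
have newN x y : X2 x -> X2 y -> ~ X (new x y).
  by move=> X2x X2y; apply: phiN; apply: fX; exact: rhoX.
pose G' := G `|` [set p | [/\ X2 p.1.1, X2 p.1.2, ~ (X p.1.1 /\ X p.1.2) &
                            p.2 = new p.1.1 p.1.2]].
have GX x y z : G (x, y, z) -> [/\ X x, X y & X z].
  move=> Gz; have [Xx Xy] := Gdom _ _ _ Gz; split=> //.
  by have [w Xw Gw] := Gtot _ _ Xx Xy; rewrite (Gfun _ _ _ _ Gz Gw).
have DG' : diag_dom G' = X2.
  apply/seteqP; split=> [x [z [Gz|[]//]]|x X2x]; first by left; exists z.
  have [[z Gz]|nXx] := pselect (X x); first by exists z; left.
  by exists (new x x); right; split=> // -[].
have newX2 x y : X2 x -> X2 y -> X2 (new x y).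
  by move=> X2x X2y; right; exists (f (rho x, rho y)) => //; apply: fX; exact: rhoX.
exists G'; last first.
  split=> [|GG']; first by left.
  have : G' (phi c, phi c, new (phi c) (phi c)).
    right; split=> //=; [by right; exists c..|].
    by move=> [Xpc _]; exact: (phiN c).
  move=> /GG'/GX[_ _]; apply: newN; by right; exists c.
split; rewrite ?DG'.
- move=> x y X2x X2y; have [[Xx Xy]|nX] := pselect (X x /\ X y).
    by have [z Xz Gz] := Gtot _ _ Xx Xy; exists z; left.
  by exists (new x y); [exact: newX2|right].
- move=> x y z [/GX[Xx Xy _]|[]//].
  by split; left.
- move=> x y z z' [Gz|[/= X2x X2y nX ->]] [Gz'|[/= X2x' X2y' nX' ->]] //.
  + exact: Gfun Gz Gz'.
  + by case: nX'; have [] := GX _ _ _ Gz.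
  + by case: nX; have [] := GX _ _ _ Gz'.
- move=> x y x' y' z [Gz|[/= X2x X2y nX zE]] [Gz'|[/= X2x' X2y' nX' zE']].
  + exact: Ginj Gz Gz'.
  + by have [_ _] := GX _ _ _ Gz; rewrite zE' => /newN; case.
  + by have [_ _] := GX _ _ _ Gz'; rewrite zE => /newN; case.
  + have [rx rx' ry ry'] := And4 (rhoX _ X2x) (rhoX _ X2x')
      (rhoX _ X2y) (rhoX _ X2y').
    have := phi_inj _ _ (fX _ _ rx ry) (fX _ _ rx' ry') (etrans (esym zE) zE').
    by move=> /(fI _ _ _ _ rx ry rx' ry')[/rho_inj-> // /rho_inj->].
Qed.

Lemma embeds_nat (T : Type) : infinite_set [set: T] -> embeds nat T.
Proof.
elim/Ppointed: T => T Tinf.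
  by have [t] := infinite_setN0 Tinf; rewrite (empty_eq0 setT).
have /infiniteP/pcard_leTP[f] := Tinf.
by exists f => m n; apply: inj; rewrite inE.
Qed.

(** Zorn's lemma enlarges the pairing on a countable subset to a maximal one, with domain [X]. By
    maximality [X] does not embed in its complement, so the complement embeds in [X]; then [T]
    embeds in two tagged copies of [X], hence in [X]. *)
Lemma infinite_square_embeds (T : Type) :
  infinite_set [set: T] -> embeds (T * T) T.
Proof.
move=> Tinf.
have [e e_inj] := embeds_nat Tinf.
pose G0 : set (T * T * T) :=
  [set (e q.1, e q.2, e (pickle (q : nat * nat))) | q in setT].
have DG0 : diag_dom G0 = range e.
  apply/seteqP; split=> [x [z [[m n] _ [<- _ _]]]|_ [m _ <-]]; first by exists m.
  by exists (e (pickle (m, m))); exists (m, m).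
have sG0 : square_graph G0.
  split; rewrite ?DG0.
  - move=> _ _ [m _ <-] [n _ <-]; exists (e (pickle (m, n))); first exact: imageT.
    by exists (m, n).
  - by move=> _ _ _ [[m n] _ [<- <- _]]; split; exact: imageT.
  - by move=> x y z z' [[m n] _ [<- <- <-]] [[m' n'] _ [/e_inj-> /e_inj-> <-]].
  - move=> x y x' y' z [[m n] _ [<- <- <-]] [[m' n'] _ [<- <- /e_inj pp]].
    by have [-> ->] := pcan_inj pickleK pp.
have [F sF Ftot|M [sM Mmax]] := @Zorn_bigcup _ (fun G => square_graph (G0 `|` G)).
  exact: square_graph_chain.
set G := G0 `|` M in sM; pose X := diag_dom G.
have Xe n : X (e n).
  by exists (e (pickle (n, n))); left; exists (n, n).
have c01 : e 0 <> e 1 by move/e_inj.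
have [emb|[psi [psiX psi_inj]]] := set_embeds_total X (~` X).
  have [G' sG' [GG' nG']] := square_graph_extend sM (Xe 0) (Xe 1) c01 emb.
  have [] := Mmax G'.
    split=> [p Mp|G'M]; first by apply: GG'; right.
    by apply: nG' => p /G'M Mp; right.
  suff -> : G0 `|` G' = G' by [].
  by apply/setUidPr => p G0p; apply: GG'; left.
have [f [fX fI]] := square_graph_fun sM.
pose i x := if pselect (X x) then f (e 0, x) else f (e 1, psi x).
have iX x : X (i x).
  by rewrite /i; case: pselect => Xx;
    [exact: fX (Xe 0) Xx|exact: fX (Xe 1) (psiX _ Xx)].
have i_inj : injective i.
  move=> x y; rewrite /i; case: pselect => Xx; case: pselect => Xy ixy.
  - by have [] := fI _ _ _ _ (Xe 0) Xx (Xe 0) Xy ixy.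
  - by have [] := fI _ _ _ _ (Xe 0) Xx (Xe 1) (psiX _ Xy) ixy.
  - by have [/esym] := fI _ _ _ _ (Xe 1) (psiX _ Xx) (Xe 0) Xy ixy.
  - have [_] := fI _ _ _ _ (Xe 1) (psiX _ Xx) (Xe 1) (psiX _ Xy) ixy.
    exact: psi_inj.
exists (fun p => f (i p.1, i p.2)) => -[x y] [x' y'] /= ff.
by have [/i_inj-> /i_inj->] := fI _ _ _ _ (iX x) (iX y) (iX x') (iX y') ff.
Qed.

(** * Finite transitivity of the homeomorphisms of a Cantor cube *)

Lemma finite_set_ind (X : Type) (P : set X -> Prop) :
  P set0 ->
  (forall a D, finite_set D -> ~ D a -> P D -> P (a |` D)) ->
  forall D, finite_set D -> P D.
Proof.
elim/Peq: X P => X P P0 PU _ /finite_seqP[s ->].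
elim: s => [|a s IH]; first by rewrite set_nil.
rewrite (_ : [set` a :: s] = a |` [set` s]); last first.
  apply/seteqP; split=> x /=; rewrite inE; first by move=> /predU1P.
  by move=> ?; apply/predU1P.
have [as_|/negP nas] := boolP (a \in s).
  by rewrite setUidr // => x ->.
exact: PU.
Qed.

Definition inverses (X : Type) (f f' : X -> X) : Prop :=
  cancel f f' /\ cancel f' f.

Lemma inverses_comp (X : Type) (f f' g g' : X -> X) :
  inverses f f' -> inverses g g' -> inverses (g \o f) (f' \o g').
Proof. by move=> [fK f'K] [gK g'K]; split; apply: can_comp. Qed.

(** Induction on the domain: once [f] agrees with [h] on [D], a further element moving [f a] to
    [h a] and fixing the image of [D] corrects the remaining point. *)
Lemma finitely_transitive (X : Type) (H : (X -> X) -> (X -> X) -> Prop) :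
  (forall f f', H f f' -> inverses f f') ->
  H id id ->
  (forall f f' g g', H f f' -> H g g' -> H (g \o f) (f' \o g')) ->
  (forall a b D, finite_set D -> ~ D a -> ~ D b ->
     exists f f', [/\ H f f', f a = b & forall x, D x -> f x = x]) ->
  forall D, finite_set D -> forall h : X -> X, set_inj D h ->
    exists f f', H f f' /\ forall x, D x -> f x = h x.
Proof.
move=> Hinv H1 Hcomp Hswap; apply: finite_set_ind => [h _|a D Dfin nDa IH h hinj].
  by exists id, id; split.
have [|f [f' [Hf fh]]] := IH h.
  by move=> x y; rewrite !inE => Dx Dy; apply: hinj; rewrite inE; right.
have [||| s [s' [Hs sa sD]]] := Hswap (f a) (h a) (h @` D).
- exact: finite_image.
- move=> [x Dx]; rewrite -fh // => /(can_inj (Hinv _ _ Hf).1) xa.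
  by apply: nDa; rewrite -xa.
- move=> [x Dx] /hinj; rewrite !inE => xa; apply: nDa.
  by rewrite -xa //; [right|left].
exists (s \o f), (f' \o s'); split=> [|x [->//|Dx]]; first exact: Hcomp.
by rewrite /= fh // sD //; exists x.
Qed.

Lemma finite_injection_extends (X : Type) (D : set X) (h : X -> X) :
  finite_set D -> set_inj D h ->
  exists f f', inverses f f' /\ forall x, D x -> f x = h x.
Proof.
move=> Dfin; move: D Dfin h; apply: finitely_transitive => //.
  by move=> f f' g g'; exact: inverses_comp.
elim/Peq: X => X a b D _ nDa nDb.
pose f x := if x == a then b else if x == b then a else x.
have fK : cancel f f.
  move=> x; rewrite /f; have [->|xa] := eqVneq x a.
    by rewrite eqxx; case: eqP.
  have [->|xb] := eqVneq x b; first by rewrite eqxx.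
  by rewrite (negbTE xa) (negbTE xb).
exists f, f; split=> [//||x Dx]; first by rewrite /f eqxx.
by rewrite /f; case: eqP => [xa|_]; [case: nDa; rewrite -xa|
  case: eqP => // xb; case: nDb; rewrite -xb].
Qed.

(* Polynomials over the two-element field, as lists of monomials: these are    *)
(* exactly the clopen functions on the cube.                                   *)
Definition peval (I : Type) (p : seq (seq I)) (y : I -> bool) : bool :=
  foldr (fun m b => all y m (+) b) false p.

Definition poly (I : Type) : set ((I -> bool) -> bool) := range (@peval I).

Lemma poly_coord (I : Type) (i : I) : poly (fun y => y i).
Proof.
by exists [:: [:: i]] => //; apply/funext => y; rewrite /peval /= andbT addbF.
Qed.

Lemma poly_zero (I : Type) : poly (fun _ : I -> bool => false).
Proof. by exists [::]. Qed.

Lemma poly_one (I : Type) : poly (fun _ : I -> bool => true).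
Proof. by exists [:: [::]]. Qed.

Lemma poly_add (I : Type) (u v : (I -> bool) -> bool) :
  poly u -> poly v -> poly (fun y => u y (+) v y).
Proof.
move=> [p _ <-] [q _ <-]; exists (p ++ q) => //; apply/funext => y.
by elim: p => //= m p IH; rewrite IH addbA.
Qed.

Lemma poly_mul (I : Type) (u v : (I -> bool) -> bool) :
  poly u -> poly v -> poly (fun y => u y && v y).
Proof.
move=> [p _ <-] pv; elim: p => [|m p IH]; first exact: poly_zero.
rewrite [X in poly X](_ : _ =
  (fun y => (all y m && v y) (+) (peval p y && v y))); last first.
  by apply/funext => y /=; rewrite andb_addl.
apply: poly_add => //; have [q _ <-] := pv; exists (map (cat m) q) => //.
apply/funext => y; elim: q => [|n q IHq] /=; first by rewrite andbF.
by rewrite IHq all_cat andb_addr.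
Qed.

Lemma poly_not (I : Type) (u : (I -> bool) -> bool) :
  poly u -> poly (fun y => ~~ u y).
Proof.
move=> pu; rewrite [X in poly X](_ : _ = fun y => u y (+) true).
  exact: poly_add pu (poly_one I).
by apply/funext => y; rewrite addbT.
Qed.

Definition poly_map (I J : Type) (t : (I -> bool) -> (J -> bool)) : Prop :=
  forall j, poly (fun y => t y j).

Lemma poly_comp (I J : Type) (t : (I -> bool) -> (J -> bool)) u :
  poly_map t -> poly u -> poly (u \o t).
Proof.
move=> pt [p _ <-]; elim: p => [|m p IH]; first exact: poly_zero.
apply: poly_add IH; elim: m => [|i m IHm]; first exact: poly_one.
exact: poly_mul.
Qed.

(** A product with one factor for each [b] in [D], testing a coordinate at which [a] and [b]
    differ. *)
Lemma poly_separates (I : Type) (a : I -> bool) (D : set (I -> bool)) :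
  finite_set D -> ~ D a ->
  exists u, [/\ poly u, u a & forall y, D y -> u y = false].
Proof.
elim/finite_set_ind: D / => [_|b D Dfin nDb IH naD].
  by exists (fun=> true); split=> //; exact: poly_one.
have [|u [pu ua uD]] := IH; first by move=> Da; apply: naD; right.
have [i abi] : exists i, a i <> b i.
  apply/existsNP => ab; apply: naD; left; exact/funext.
exists (fun y => u y && ~~ (y i (+) a i)); split.
- by apply/poly_mul/poly_not/poly_add => //; [exact: poly_coord|
    case: (a i); [exact: poly_one|exact: poly_zero]].
- by rewrite ua addbb.
- move=> y [->|/uD->//]; apply/andP => -[_ /negP]; apply.
  by case: (a i) abi; case: (b i).
Qed.

Definition homeo (I : Type) (t t' : (I -> bool) -> (I -> bool)) : Prop :=
  [/\ inverses t t', poly_map t & poly_map t'].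

Lemma homeo_id (I : Type) : homeo (@id (I -> bool)) id.
Proof. by split=> // i; exact: poly_coord. Qed.

Lemma homeo_comp (I : Type) (s s' t t' : (I -> bool) -> (I -> bool)) :
  homeo s s' -> homeo t t' -> homeo (t \o s) (s' \o t').
Proof.
move=> [sK ps ps'] [tK pt pt']; split; first exact: inverses_comp.
  by move=> i; apply: (poly_comp ps (pt i)).
by move=> i; apply: (poly_comp pt' (ps' i)).
Qed.

(* Translate by [a + b], but only on the clopen set [c], which contains [a] and *)
(* [b], misses [D], and is invariant under the translation.                     *)
Lemma homeo_swap (I : Type) (a b : I -> bool) (D : set (I -> bool)) :
  finite_set D -> ~ D a -> ~ D b ->
  exists t t', [/\ homeo t t', t a = b & forall y, D y -> t y = y].
Proof.
move=> Dfin nDa nDb; pose tr (y : I -> bool) := fun i => y i (+) (a i (+) b i).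
have trK : involutive tr.
  by move=> y; apply/funext => i; rewrite /tr -addbA addbb addbF.
have tra : tr a = b by apply/funext => i; rewrite /tr addbA addbb.
have ptr : poly_map tr.
  move=> i; apply: poly_add; first exact: poly_coord.
  by case: (_ (+) _); [exact: poly_one|exact: poly_zero].
have [||u [pu ua uD]] := @poly_separates _ a (D `|` tr @` D).
- by rewrite finite_setU; split=> //; exact: finite_image.
- move=> [//|[y Dy ya]]; apply: nDb; suff -> : b = y by [].
  by rewrite -tra -ya trK.
pose c y := ~~ (~~ u y && ~~ u (tr y)).
have pc : poly c.
  by apply/poly_not/poly_mul; apply: poly_not => //; exact: (poly_comp ptr).
have ctr y : c (tr y) = c y by rewrite /c trK andbC.
pose t y := if c y then tr y else y.
have tK : cancel t t.
  by move=> y; rewrite /t; case cy: (c y); rewrite ?ctr cy.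
have pt : poly_map t.
  move=> i; rewrite [X in poly X](_ : _ =
    (fun y => (c y && (a i (+) b i)) (+) y i)).
    apply: poly_add; last exact: poly_coord.
    by apply: poly_mul => //; case: (_ (+) _); [exact: poly_one|exact: poly_zero].
  by apply/funext => y; rewrite /t; case: (c y) => //=; rewrite /tr addbC.
exists t, t; split=> [//||y Dy]; first by rewrite /t /c ua.
by rewrite /t /c !uD //; [right; exists y|left].
Qed.

Lemma homeo_transitive (I : Type) (D : set (I -> bool)) (h : _ -> I -> bool) :
  finite_set D -> set_inj D h ->
  exists t t', homeo t t' /\ forall y, D y -> t y = h y.
Proof.
move=> Dfin; move: D Dfin h; apply: finitely_transitive.
- by move=> t t' [].
- exact: homeo_id.
- by move=> f f' g g'; exact: homeo_comp.
- exact: homeo_swap.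
Qed.

(** * Cardinality bounds and direct limits *)

Lemma embeds_prod (X Y T : Type) :
  infinite_set [set: T] -> embeds X T -> embeds Y T -> embeds (X * Y) T.
Proof.
move=> /infinite_square_embeds[p pI] [f fI] [g gI].
by exists (fun q => p (f q.1, g q.2)) => -[x y] [x' y'] /pI[/fI-> /gI->].
Qed.

Lemma embeds_sum (X Y T : Type) :
  infinite_set [set: T] -> embeds X T -> embeds Y T -> embeds (X + Y) T.
Proof.
move=> Tinf [f fI] [g gI]; have [e eI] := embeds_nat Tinf.
have [p pI] := infinite_square_embeds Tinf.
exists (fun s => match s with inl x => p (e 0, f x) | inr y => p (e 1, g y) end).
by move=> [x|y] [x'|y'] /pI[]; [move/fI->|move/eI|move/eI|move/gI->].
Qed.

(** The iterated pairing [c] is sure to be injective only among lists of equal length, so the length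
    is stored beside it. *)
Lemma embeds_seq (X T : Type) :
  infinite_set [set: T] -> embeds X T -> embeds (seq X) T.
Proof.
move=> Tinf [f fI]; have [e eI] := embeds_nat Tinf.
have [p pI] := infinite_square_embeds Tinf.
pose c := fix c s := if s is x :: s' then p (f x, c s') else e 0.
have cI s s' : size s = size s' -> c s = c s' -> s = s'.
  by elim: s s' => [|x s IH] [|x' s'] //= [/IH{}IH] /pI[/fI-> /IH->].
exists (fun s => p (e (size s), c s)) => s s' /pI[/eI]; exact: cI.
Qed.

Lemma embeds_sigma (F : nat -> Type) (T : Type) :
  infinite_set [set: T] -> (forall n, embeds (F n) T) -> embeds {n & F n} T.
Proof.
move=> Tinf eF; have [e eI] := embeds_nat Tinf.
have [p pI] := infinite_square_embeds Tinf.
pose f n := sval (cid (eF n)); have fI n : injective (f n) := svalP (cid (eF n)).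
exists (fun s => p (e (tag s), f _ (tagged s))) => -[n x] [m y] /= /pI[/eI nm].
by subst m; move=> /fI->.
Qed.

Definition poly_fun (I : Type) := {u : (I -> bool) -> bool | poly u}.

Lemma poly_fun_eq (I : Type) (u v : poly_fun I) : sval u =1 sval v -> u = v.
Proof. by case: u v => [u pu] [v pv] /= /funext uv; exact: eq_exist. Qed.

Lemma embeds_poly_fun (I T : Type) :
  infinite_set [set: T] -> embeds I T -> embeds (poly_fun I) T.
Proof.
move=> Tinf /(embeds_seq Tinf)/(embeds_seq Tinf); apply: embeds_trans.
have /choice[f fP] (u : poly_fun I) : exists p, peval p = sval u.
  by have [p _ pu] := svalP u; exists p.
by exists f => u v uv; apply: poly_fun_eq => y; rewrite -!fP uv.
Qed.

(** An element of the limit is represented by its ancestor of least level, its [root]. The set of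
    roots embeds in [T] and contains a copy of [T] from level zero, so Cantor-Bernstein identifies
    it with all of [T]. *)
Lemma direct_limit (T : Type) (B : nat -> Type) (i : forall n, B n -> B n.+1) :
  infinite_set [set: T] -> (forall n, injective (@i n)) ->
  embeds T (B 0) -> (forall n, embeds (B n) T) ->
  exists j : forall n, B n -> T, [/\ forall n, injective (j n),
    forall n b, j n.+1 (i n b) = j n b & forall t, exists n b, j n b = t].
Proof.
move=> Tinf iI [e eI] eB.
pose root := fix root n : B n -> {n & B n} := match n with
  | 0 => fun b => existT B 0 b
  | n.+1 => fun c => match pselect (exists b, i n b = c) with
      | left ex => root n (sval (cid ex))
      | right _ => existT B n.+1 c
      end
  end.
have root_i n b : root n.+1 (i n b) = root n b.
  rewrite /=; case: pselect => [ex|[]]; last by exists b.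
  by congr (root n _); exact: iI (svalP (cid ex)).
have root_le n b : tag (root n b) <= n.
  elim: n b => //= n IH b; case: pselect => //= ex; exact: leqW.
have rootI n : injective (root n).
  elim: n => [|n IH] b c; first exact: (@eq_from_Tagged _ B).
  rewrite /=; case: pselect => [eb|_]; case: pselect => [ec|_].
  - move=> /IH bc.
    by rewrite -(svalP (cid eb)) -(svalP (cid ec)) bc.
  - by move=> r; have := root_le n (sval (cid eb)); rewrite r /= ltnn.
  - by move=> r; have := root_le n (sval (cid ec)); rewrite -r /= ltnn.
  - exact: (@eq_from_Tagged _ B).
pose R : set {n & B n} := [set d | exists n b, root n b = d].
have [D DI] := embeds_sigma Tinf eB.
have [h [_ hI hS]] : exists h, set_bij R [set: T] h.
  elim/Ppointed: T => T in Tinf e eI D DI eB *.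
    by have [t] := infinite_setN0 Tinf; rewrite (empty_eq0 setT).
  apply/card_set_bijP/Cantor_Bernstein.
    by apply/pcard_injP; exists D => x y _ _; exact: DI.
  have eRI : injective (root 0 \o e) by apply: inj_comp eI; exact: rootI.
  rewrite -(card_le_eql (inj_card_eq (in2W eRI))); apply: subset_card_le.
  by move=> _ [t _ <-]; exists 0, (e t).
exists (fun n b => h (root n b)); split=> [n b c|n b|t].
- by move=> /hI bc; apply: rootI; apply: bc; rewrite inE; eexists; eexists.
- by rewrite root_i.
- by have [_ [n [b <-]] <-] := hS t I; exists n, b.
Qed.

(** * The extension step *)

(* The sets of a stage are the points of the cube [idx -> bool].              *)
Record stage := Stage {
  idx : Type;
  pnt : Type;
  inc : pnt -> (idx -> bool) -> bool
}.

Definition cube (M : stage) : Type := idx M -> bool.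

Definition lres (I J : Type) (y : I + J -> bool) : I -> bool := fun i => y (inl i).

Definition next (M : stage) : stage :=
  @Stage (idx M + pnt M) (pnt M * poly_fun (idx M))
    (fun p y => sval p.2 (lres y) (+) y (inr p.1)).

Definition emb_pnt (M : stage) (x : pnt M) : pnt (next M) :=
  (x, exist (@poly (idx M)) (fun=> false) (@poly_zero (idx M))).

Definition emb_set (M : stage) (y : cube M) : cube (next M) :=
  fun k => match k with inl i => y i | inr x => inc x y end.

Lemma emb_pnt_inj (M : stage) : injective (@emb_pnt M).
Proof. by move=> x x' []. Qed.

Lemma inc_emb (M : stage) (x : pnt M) (y : cube M) :
  inc (emb_pnt x) (emb_set y) = inc x y.
Proof. by []. Qed.

(** The action on sets must be a homeomorphism: precomposition with it then keeps the second
    components of the points of the next stage clopen, so that automorphisms can be lifted. *)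
Record aut (M : stage) := MkAut {
  apnt : pnt M -> pnt M;
  apntV : pnt M -> pnt M;
  aset : cube M -> cube M;
  asetV : cube M -> cube M;
  apntK : inverses apnt apntV;
  asetK : homeo aset asetV;
  aut_inc : forall x y, inc (apnt x) (aset y) = inc x y
}.

Definition aut_id (M : stage) : aut M :=
  MkAut (conj (fun _ => erefl) (fun _ => erefl)) (homeo_id (idx M))
    (fun _ _ => erefl).

Lemma homeoV (I : Type) (t t' : (I -> bool) -> (I -> bool)) :
  homeo t t' -> homeo t' t.
Proof. by move=> [[]]. Qed.

Lemma aset_inv (M : stage) (a : aut M) : inverses (aset a) (asetV a).
Proof. by case: (asetK a). Qed.

Lemma aut_incV (M : stage) (a : aut M) x y :
  inc (apntV a x) (asetV a y) = inc x y.
Proof.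
by rewrite -(aut_inc a) (apntK a).2 (aset_inv a).2.
Qed.

Definition aut_inv (M : stage) (a : aut M) : aut M :=
  MkAut (conj (apntK a).2 (apntK a).1) (homeoV (asetK a)) (aut_incV a).

(* [f] and [t] need not be compatible, because the points of the next stage    *)
(* carry a second component that is free to be corrected by [phi].             *)
Lemma twist (M : stage) (f f' : pnt M -> pnt M) (t t' : cube M -> cube M)
    (phi : pnt M -> cube M -> bool) :
  inverses f f' -> homeo t t' -> (forall x, poly (phi x)) ->
  exists a : aut (next M), [/\
    forall x, phi x = (fun=> false) -> apnt a (emb_pnt x) = emb_pnt (f x),
    forall y i, aset a y (inl i) = t (lres y) i &
    forall y x, aset a y (inr (f x)) = y (inr x) (+) phi x (lres y)].
Proof.
move=> [fK f'K] [[tK t'K] pt pt'] pphi.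
have plres : poly_map (@lres (idx M) (pnt M)) by move=> i; exact: poly_coord.
have pg x (u : poly_fun (idx M)) : poly (fun y => sval u (t' y) (+) phi x (t' y)).
  by apply: poly_add; apply: (poly_comp pt'); [exact: svalP|].
have pg' x (u : poly_fun (idx M)) : poly (fun y => sval u (t y) (+) phi x y).
  by apply: poly_add => //; apply: (poly_comp pt); exact: svalP.
(* The second component becomes [u + phi x] transported along [t']. At [t (lres y)] this contributes
   the extra term [phi x (lres y)], cancelled by the same term in [s]. *)
pose g (p : pnt (next M)) : pnt (next M) := (f p.1, exist _ _ (pg p.1 p.2)).
pose g' (p : pnt (next M)) : pnt (next M) :=
  (f' p.1, exist _ _ (pg' (f' p.1) p.2)).
pose s (y : cube (next M)) : cube (next M) := fun k => match k with
  | inl i => t (lres y) i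
  | inr x => y (inr (f' x)) (+) phi (f' x) (lres y) end.
pose s' (y : cube (next M)) : cube (next M) := fun k => match k with
  | inl i => t' (lres y) i
  | inr x => y (inr (f x)) (+) phi x (t' (lres y)) end.
have gK : cancel g g'.
  move=> [x u]; rewrite /g /g' /=; congr pair; first exact: fK.
  by apply: poly_fun_eq => y /=; rewrite fK tK -addbA addbb addbF.
have g'K : cancel g' g.
  move=> [x u]; rewrite /g /g' /=; congr pair; first exact: f'K.
  by apply: poly_fun_eq => y /=; rewrite t'K -addbA addbb addbF.
have ls y : lres (s y) = t (lres y) by exact/funext.
have ls' y : lres (s' y) = t' (lres y) by exact/funext.
have sK : cancel s s'.
  move=> y; apply/funext => -[i|x]; rewrite /s' ls tK //.
  by rewrite /s fK -addbA addbb addbF.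
have s'K : cancel s' s.
  move=> y; apply/funext => -[i|x]; rewrite /s ls' ?t'K //.
  by rewrite /s' f'K -addbA addbb addbF.
have ps : poly_map s.
  move=> [i|x]; first exact: (poly_comp plres (pt i)).
  by apply: poly_add; [exact: poly_coord|exact: (poly_comp plres)].
have ps' : poly_map s'.
  move=> [i|x]; first exact: (poly_comp plres (pt' i)).
  apply: poly_add; first exact: poly_coord.
  exact: (poly_comp plres (poly_comp pt' (pphi x))).
have sinc p y : inc (g p) (s y) = inc p y.
  rewrite /= ls tK fK.
  by case: (sval p.2 _); case: (phi _ _); case: (y _).
exists (MkAut (conj gK g'K) (And3 (conj sK s'K) ps ps') sinc); split=> //=.
  move=> x phi0; rewrite /g /emb_pnt /=; congr pair.
  by apply: poly_fun_eq => y /=; rewrite phi0.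
by move=> y x; rewrite fK.
Qed.

Definition lifts (M : stage) (a : aut M) (b : aut (next M)) : Prop :=
  (forall x, apnt b (emb_pnt x) = emb_pnt (apnt a x)) /\
  (forall y, aset b (emb_set y) = emb_set (aset a y)).

Lemma lift_exists (M : stage) (a : aut M) : exists b, lifts a b.
Proof.
have p0 (x : pnt M) := @poly_zero (idx M).
have [b [bp bl br]] := twist (apntK a) (asetK a) p0.
exists b; split=> [x|y]; first exact: bp.
apply/funext => -[i|x]; first by rewrite bl.
by rewrite -((apntK a).2 x) br addbF /= -(aut_inc a) (apntK a).2.
Qed.

Lemma lifts_inv (M : stage) (a : aut M) (b : aut (next M)) :
  lifts a b -> lifts (aut_inv a) (aut_inv b).
Proof.
move=> [ab_p ab_s]; split=> [x|y] /=.
  by apply: (can_inj (apntK b).1); rewrite (apntK b).2 ab_p (apntK a).2.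
by apply: (can_inj (aset_inv b).1); rewrite (aset_inv b).2 ab_s (aset_inv a).2.
Qed.

Lemma partial_aut_extends (M : stage) (D : set (pnt M)) (S : set (cube M)) h k :
  (forall x : pnt M, poly (inc x)) ->
  finite_set D -> set_inj D h -> finite_set S -> set_inj S k ->
  (forall x y, D x -> S y -> inc (h x) (k y) = inc x y) ->
  exists a : aut (next M),
    (forall x, D x -> apnt a (emb_pnt x) = emb_pnt (h x)) /\
    (forall y, S y -> aset a (emb_set y) = emb_set (k y)).
Proof.
move=> pinc Dfin hI Sfin kI hk.
have [f [f' [fK fh]]] := finite_injection_extends Dfin hI.
have [t [t' [tH tk]]] := homeo_transitive Sfin kI.
(* The correction is the failure of incidence under [f] and [t]. It is set to zero on [D], so that
   embedded points go to embedded points; on [S] nothing is lost, by the compatibility of [h] and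
   [k]. *)
pose phi x y := if pselect (D x) then false else inc x y (+) inc (f x) (t y).
have [_ pt _] := tH.
have pphi x : poly (phi x).
  rewrite /phi; case: pselect => Dx /=; first exact: poly_zero.
  exact: poly_add (poly_comp pt (pinc _)).
have [a [ap al ar]] := twist fK tH pphi.
exists a; split=> [x Dx|y Sy].
  by rewrite -fh //; apply: ap; apply/funext => y; rewrite /phi; case: pselect.
apply/funext => -[i|x]; first by rewrite al -tk.
rewrite -(fK.2 x) ar /= -tk //; set z := f' x.
have -> : lres (emb_set y) = y by exact/funext.
rewrite /phi; case: pselect => Dz; last by rewrite addbA addbb.
by rewrite addbF tk // fh // hk.
Qed.

(** * The tower and its limit *)

Fixpoint tower (T : Type) (n : nat) : stage :=
  if n is m.+1 then next (tower T m) else @Stage T T (fun x y => y x).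

Lemma tower_poly (T : Type) (n : nat) (x : pnt (tower T n)) : poly (inc x).
Proof.
elim: n x => [|n IH] x; first exact: poly_coord.
apply: poly_add; last exact: poly_coord.
by apply: (@poly_comp _ _ (@lres _ _)); [move=> i; exact: poly_coord|exact: svalP].
Qed.

Lemma tower_embeds (T : Type) (n : nat) : infinite_set [set: T] ->
  embeds (idx (tower T n)) T /\ embeds (pnt (tower T n)) T.
Proof.
move=> Tinf; elim: n => [|n [IHi IHp]]; first by split; exists id.
split; first exact: embeds_sum.
by apply: embeds_prod => //; exact: embeds_poly_fun.
Qed.

Record tower_limit (T : Type) (j : forall n, pnt (tower T n) -> T) : Prop := {
  lim_inj : forall n, injective (j n);
  lim_emb : forall n x, j n.+1 (emb_pnt x) = j n x;
  lim_surj : forall t, exists n x, j n x = t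
}.

Lemma tower_limit_exists (T : Type) : infinite_set [set: T] ->
  exists j : forall n, pnt (tower T n) -> T, tower_limit j.
Proof.
move=> Tinf; have [||n|j [jI je js]] := @direct_limit T (fun n => pnt (tower T n))
  (fun n => @emb_pnt (tower T n)) Tinf.
- by move=> n; exact: emb_pnt_inj.
- by exists id.
- by have [] := tower_embeds n Tinf.
- by exists j.
Qed.

(** Shifting the family [F] reduces to [N = 0]; the values [dflt] fill the levels below [N]. *)
Lemma tail_sequence (F : nat -> Type) (step : forall n, F n -> F n.+1) N (y : F N) :
  (forall n, F n) ->
  exists s : forall n, F n, s N = y /\ forall m, N <= m -> s m.+1 = step m (s m).
Proof.
elim: N F step y => [|N IH] F step y dflt.
  by exists (fun n => nat_rect F y step n).
have [s [sN ss]] := IH (fun n => F n.+1) (fun n => step n.+1) y (fun n => dflt n.+1).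
exists (fun n => if n is m.+1 then s m else dflt 0); split=> // -[//|m].
exact: ss.
Qed.

Lemma lim_push (T : Type) (j : forall n, pnt (tower T n) -> T)
    (P : forall m, pnt (tower T m) -> Prop) N : tower_limit j ->
  (forall m x, N <= m -> P m x -> P m.+1 (emb_pnt x)) ->
  forall m m' x, N <= m -> m <= m' -> P m x -> exists2 x', j m' x' = j m x & P m' x'.
Proof.
move=> jL Pe m m' x Nm; elim: m' => [|m' IH].
  by rewrite leqn0 => /eqP m0; subst m => Px; exists x.
rewrite leq_eqVlt => /predU1P[mm'|]; first by subst m => Px; exists x.
rewrite ltnS => mm' /(IH mm')[x' jx' Px']; exists (emb_pnt x').
  by rewrite lim_emb.
by apply: Pe Px'; exact: leq_trans mm'.
Qed.

Lemma lim_at (T : Type) (j : forall n, pnt (tower T n) -> T) N t :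
  tower_limit j -> exists m x, N <= m /\ j m x = t.
Proof.
move=> jL; have [m [x <-]] := lim_surj jL t.
have [||||x' jx _] := @lim_push _ _ (fun _ _ => True) 0 jL _ m (maxn N m) x => //.
  exact: leq_maxr.
by exists (maxn N m), x'; rewrite leq_maxl.
Qed.

(** Two representatives of the same element, pushed to a common level, coincide there by injectivity
    of [j], so the value does not depend on the representative. *)
Lemma lim_glue (T U : Type) (j : forall n, pnt (tower T n) -> T) N
    (v : forall m, pnt (tower T m) -> U) : tower_limit j ->
  (forall m x, N <= m -> v m.+1 (emb_pnt x) = v m x) ->
  exists f : T -> U, forall m x, N <= m -> f (j m x) = v m x.
Proof.
move=> jL ve.
have /choice[f fP] t : exists u, exists m x, [/\ N <= m, j m x = t & v m x = u].
  by have [m [x [Nm jx]]] := lim_at N t jL; exists (v m x), m, x.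
exists f => m x Nm; have [m0 [x0 [Nm0 jx0 <-]]] := fP (j m x).
have push k (z : pnt (tower T k)) l : N <= k -> k <= l ->
    exists2 z', j l z' = j k z & v l z' = v k z.
  by move=> Nk kl; apply: (lim_push (N := N) (P := fun l z' => v l z' = v k z) jL)
    => // l' z' Nl' <-; exact: ve.
have [z jz <-] := push m0 x0 (maxn m0 m) Nm0 (leq_maxl _ _).
have [z' jz' <-] := push m x (maxn m0 m) Nm (leq_maxr _ _).
by congr (v _ _); apply: (lim_inj jL); rewrite jz jz'.
Qed.

(* From level [N] on, [y] is the sequence of canonical images of [y N], and   *)
(* [X] is the set of points that it describes.                                *)
Definition tracks (T : Type) (j : forall n, pnt (tower T n) -> T) N
    (y : forall m, cube (tower T m)) (X : set T) : Prop :=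
  (forall m, N <= m -> y m.+1 = emb_set (y m)) /\
  (forall m x, N <= m -> (X (j m x) <-> inc x (y m))).

Definition universal_family (T : Type) (j : forall n, pnt (tower T n) -> T) :
  set (set T) := [set X | exists N y, tracks j N y X].

Lemma tracks_le (T : Type) (j : forall n, pnt (tower T n) -> T) N N' y X :
  N <= N' -> tracks j N y X -> tracks j N' y X.
Proof.
move=> NN' [ys yX]; split=> [m|m x] /(leq_trans NN'); [exact: ys|exact: yX].
Qed.

Lemma tracks_exists (T : Type) (j : forall n, pnt (tower T n) -> T) N
    (c : cube (tower T N)) : tower_limit j ->
  exists y X, tracks j N y X /\ y N = c.
Proof.
move=> jL; have [y [yN ys]] := tail_sequence (fun n => @emb_set (tower T n)) c
  (fun n _ => false).
have [|X XP] := @lim_glue T Prop j N (fun m x => inc x (y m)) jL.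
  by move=> m x Nm; rewrite ys // inc_emb.
by exists y, X; split=> //; split=> // m x Nm; rewrite XP.
Qed.

Lemma tracks_inj (T : Type) (j : forall n, pnt (tower T n) -> T) N y X y' X' :
  tower_limit j -> tracks j N y X -> tracks j N y' X' -> y N = y' N -> X = X'.
Proof.
move=> jL [ys yX] [ys' yX'] yN.
have yy' m : N <= m -> y m = y' m.
  elim: m => [|m IH]; first by rewrite leqn0 => /eqP N0; subst N.
  rewrite leq_eqVlt => /predU1P[Nm|]; first by subst N.
  by rewrite ltnS => Nm; rewrite ys // ys' // IH.
apply/predeqP => t; have [m [x [Nm <-]]] := lim_at N t jL.
by rewrite yX // yX' // yy'.
Qed.

Definition aut_chain (T : Type) N (a : forall m, aut (tower T m)) : Prop :=
  forall m, N <= m -> lifts (a m) (a m.+1).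

Lemma chain_fun (T : Type) (j : forall n, pnt (tower T n) -> T) N a :
  tower_limit j -> aut_chain N a ->
  exists g : T -> T, forall m x, N <= m -> g (j m x) = j m (apnt (a m) x).
Proof.
move=> jL ac; apply: (@lim_glue T T j N (fun m x => j m (apnt (a m) x)) jL).
by move=> m x Nm; have [-> _] := ac m Nm; rewrite lim_emb.
Qed.

Lemma chain_image (T : Type) (j : forall n, pnt (tower T n) -> T) N a g g' N' y X :
  tower_limit j -> aut_chain N a -> inverses g g' ->
  (forall m x, N <= m -> g (j m x) = j m (apnt (a m) x)) ->
  N <= N' -> tracks j N' y X ->
  tracks j N' (fun m => aset (a m) (y m)) (g @` X).
Proof.
move=> jL ac [gK g'K] ga NN' [ys yX]; split=> [m N'm|m x N'm].
  have [_] := ac m (leq_trans NN' N'm).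
  by rewrite ys.
have Nm := leq_trans NN' N'm.
rewrite -{2}((apntK (a m)).2 x) aut_inc -yX //.
have <- : g' (j m x) = j m (apntV (a m) x).
  by apply: (can_inj gK); rewrite g'K ga // (apntK (a m)).2.
by split=> [[t Xt <-]|Xt]; [rewrite gK|exists (g' (j m x))].
Qed.

(** Iterated lifts of [a] form a chain that glues to [g]. The inverses form a chain as well, so [g]
    is a bijection whose inverse also preserves the family. *)
Lemma aut_extends (T : Type) (j : forall n, pnt (tower T n) -> T) N
    (a : aut (tower T N)) : tower_limit j ->
  exists g, [/\ Aut (universal_family j) g,
    forall x, g (j N x) = j N (apnt a x) &
    forall y X, tracks j N y X ->
      exists2 y', tracks j N y' (g @` X) & y' N = aset a (y N)].
Proof.
move=> jL.
pose step n (b : aut (tower T n)) : aut (tower T n.+1) := sval (cid (lift_exists b)).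
have [s [sN ss]] := tail_sequence step a (fun n => aut_id (tower T n)).
have sc : aut_chain N s.
  by move=> m Nm; rewrite ss //; exact: (svalP (cid (lift_exists (s m)))).
have sVc : aut_chain N (fun m => aut_inv (s m)).
  by move=> m Nm; apply: lifts_inv; exact: sc.
have [g gP] := chain_fun jL sc.
have [g' g'P] := chain_fun jL sVc.
have gK : cancel g g'.
  move=> t; have [m [x [Nm <-]]] := lim_at N t jL.
  by rewrite gP // g'P //= (apntK (s m)).1.
have g'K : cancel g' g.
  move=> t; have [m [x [Nm <-]]] := lim_at N t jL.
  by rewrite g'P // gP //= (apntK (s m)).2.
have UF N' y X : tracks j N' y X -> tracks j (maxn N N') y X.
  by apply: tracks_le; exact: leq_maxr.
exists g; split=> [|x|y X yX].
- split; first by split=> // [x y _ _ /(can_inj gK)//|y _]; exists (g' y).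
  move=> X; split=> -[N' [y /UF yX]].
    exists (maxn N N'); eexists.
    by apply: (chain_image jL sc (conj gK g'K) gP _ yX); exact: leq_maxl.
  exists (maxn N N'); eexists; have -> : X = g' @` (g @` X).
    rewrite image_comp (_ : g' \o g = id) ?image_id //; exact/funext.
  apply: (chain_image jL sVc _ g'P _ yX); first by split.
  exact: leq_maxl.
- by rewrite gP // sN.
- exists (fun m => aset (s m) (y m)); last by rewrite sN.
  exact: (chain_image jL sc (conj gK g'K)).
Qed.

(** * Homogeneity of the limit family *)

Lemma finite_uniform (X : Type) (P : X -> nat -> Prop) (D : set X) :
  (forall x m n, m <= n -> P x m -> P x n) -> finite_set D ->
  (forall x, D x -> exists n, P x n) -> exists N, forall x, D x -> P x N.
Proof.
move=> Pm; elim/finite_set_ind: D / => [_|a D _ _ IH PD]; first by exists 0.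
have [|N NP] := IH; first by move=> x Dx; apply: PD; right.
have [|n nP] := PD a; first by left.
exists (maxn N n) => x [->|/NP].
  exact: Pm (leq_maxr _ _) nP.
exact: Pm (leq_maxl _ _).
Qed.

(** The demand is pulled back to a level [N] carrying all its points, its sets and their images.
    There it is a compatible pair of finite injections, which [partial_aut_extends] realises at
    level [N.+1]. *)
Lemma universal_family_homogeneous (T : Type)
    (j : forall n, pnt (tower T n) -> T) :
  tower_limit j -> homogeneous (universal_family j).
Proof.
move=> jL d.
set D := demand_hdom d; set h := demand_h d.
set S := demand_fdom d; set f := demand_f d.
have Dfin : finite_set D := demand_hfin d.
have Sfin : finite_set S := demand_ffin d.
have jle t m n : m <= n -> (exists x, j m x = t) -> exists x, j n x = t.
  move=> mn [x <-].
  have [x' jx _] := @lim_push T j (fun _ _ => True) 0 jL (fun _ _ _ _ => I) m n x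
    (leq0n m) mn I.
  by exists x'.
have [N1 N1P] : exists N, forall t, (D `|` h @` D) t -> exists x, j N x = t.
  apply: (finite_uniform (P := fun t n => exists x, j n x = t)) => //.
    by rewrite finite_setU; split=> //; exact: finite_image.
  by move=> t _; exact: lim_surj.
have [N2 N2P] : exists N, forall X, (S `|` f @` S) X -> exists y, tracks j N y X.
  apply: (finite_uniform (P := fun X n => exists y, tracks j n y X)).
  - by move=> X m n mn [y /(tracks_le mn)]; exists y.
  - by rewrite finite_setU; split=> //; exact: finite_image.
  - by move=> X [/(demand_fdom_sub (d := d))|[Y /(demand_ffun (d := d)) FY <-]].
pose N := maxn N1 N2.
have DN t : (D `|` h @` D) t -> exists x, j N x = t.
  by move=> /N1P; apply: jle; exact: leq_maxl.
have /choice[c cP] X : exists c : cube (tower T N),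
    (S `|` f @` S) X -> exists2 y, tracks j N y X & y N = c.
  have [/N2P[y yX]|nSX] := pselect ((S `|` f @` S) X); last by exists (fun=> false).
  by exists (y N) => _; exists y => //; apply: tracks_le yX; exact: leq_maxr.
have cI X Y : (S `|` f @` S) X -> (S `|` f @` S) Y -> c X = c Y -> X = Y.
  move=> /cP[y yX <-] /cP[y' yY <-]; exact: tracks_inj yX yY.
have SS X : S X -> (S `|` f @` S) X by left.
have SfS X : S X -> (S `|` f @` S) (f X) by right; exists X.
(* The demand on sets, transported to their codes at level [N]; it is well defined because [c] is
   injective on the sets involved. *)
have /choice[k kP] z : exists z', forall X, S X -> c X = z -> z' = c (f X).
  have [[X [SX cX]]|nz] := pselect (exists X, S X /\ c X = z); last first.
    by exists z => X SX cX; case: nz; exists X.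
  exists (c (f X)) => Y SY cY; congr (c (f _)); apply: cI; [exact: SS..|].
  by rewrite cX cY.
have /choice[hN hNP] x : exists x', D (j N x) -> j N x' = h (j N x).
  have [Dx|nDx] := pselect (D (j N x)); last by exists x.
  by have [|x' jx'] := DN (h (j N x)); [right; exists (j N x)|exists x'].
have [|||||a [aD aS]] := @partial_aut_extends (tower T N) (j N @^-1` D)
    (c @` S) hN k (@tower_poly T N).
- by apply: finite_preimage => // x y _ _; exact: (lim_inj jL).
- move=> x y; rewrite !inE => Dx Dy hxy; apply: (lim_inj jL).
  by apply: (demand_hinj (d := d)); rewrite ?inE // -/h -!hNP // hxy.
- exact: finite_image.
- move=> _ _ /set_mem[X SX <-] /set_mem[Y SY <-].
  rewrite (kP _ X) // (kP _ Y) // => /cI fXY; congr c.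
  by apply: (demand_finj (d := d)); rewrite ?inE //; apply: fXY; exact: SfS.
- move=> x _ Dx [X SX <-]; rewrite (kP _ X) //.
  have [y yX <-] := cP _ (SS _ SX); have [y' yfX <-] := cP _ (SfS _ SX).
  have := demand_compat Dx SX; rewrite -/h -/f -hNP // yX.2 // yfX.2 //.
  by move=> XfX; apply/idP/idP => /XfX.
have [g [Fg gp gs]] := @aut_extends T j N.+1 a jL.
exists g => //; split=> [t Dt|X SX].
  have [x jx] := DN t (or_introl Dt); subst t.
  by rewrite -[in LHS](lim_emb jL) gp aD // (lim_emb jL) hNP.
have [y yX yN] := cP _ (SS _ SX); have [y' yfX y'N] := cP _ (SfS _ SX).
have [z zX zN] := gs y X (tracks_le (leqnSn N) yX).
(* Members tracked from the same level are equal once their codes there agree, so the comparison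
   takes place at level [N.+1], where [a] acts. *)
apply: tracks_inj zX (tracks_le (leqnSn N) yfX) _ => //.
rewrite zN yX.1 // yfX.1 // yN y'N aS; last by exists X.
by rewrite (kP _ X).
Qed.

(** * Permutations at level zero and bi-embeddings *)

Lemma perm_aut (T : Type) (f f' : T -> T) : inverses f f' ->
  exists a : aut (tower T 0), apnt a = f.
Proof.
move=> [fK f'K].
(* A permutation acts on characteristic functions by precomposition with its inverse, which permutes
   coordinates and is therefore polynomial. *)
have cK : cancel (fun y : T -> bool => y \o f') (fun y => y \o f).
  by move=> y; apply/funext => x /=; rewrite fK.
have c'K : cancel (fun y : T -> bool => y \o f) (fun y => y \o f').
  by move=> y; apply/funext => x /=; rewrite f'K.
have pc (h : T -> T) : poly_map (fun y : T -> bool => y \o h).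
  by move=> i; exact: poly_coord.
have cinc (x : T) (y : T -> bool) : (y \o f') (f x) = y x by rewrite /= fK.
by exists (@MkAut (tower T 0) _ _ _ _ (conj fK f'K)
  (And3 (conj cK c'K) (pc f') (pc f)) cinc).
Qed.

(** The set map picks a member of [Fs] whose trace on [A] is the image of [X]. An automorphism is
    conjugated by [f] and completed by the identity off the range of [f]; this permutes [A], so it
    extends to an automorphism of [Fs]. *)
Lemma bi_embedding_of_rich (T : Type) (Fs : set (set T)) (A : set T) (f : T -> T) :
  (forall Y, Y `<=` A -> exists2 X, Fs X & X `&` A = Y) ->
  (forall s : T -> T, Sym A s ->
     exists2 g, Aut Fs g & forall x, A x -> g x = s x) ->
  injective f -> range f `<=` A ->
  forall F : set (set T), induces_bi_embedding F Fs f.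
Proof.
move=> tr sym fI fA F.
have fimA (X : set T) : f @` X `<=` A by move=> _ [x _ <-]; apply: fA; exists x.
have /choice[phi phiP] (X : set T) : exists X', Fs X' /\ X' `&` A = f @` X.
  by have [X' FX' X'A] := tr _ (fimA X); exists X'.
have phi_f X x : phi X (f x) <-> X x.
  have [_ pA] := phiP X; split=> [pX|Xx].
    have : (phi X `&` A) (f x) by split=> //; apply: fA; exists x.
    by rewrite pA => -[x' Xx' /fI <-].
  have : (phi X `&` A) (f x) by rewrite pA; exists x.
  by case.
exists phi; split.
  split=> // [X _|X Y _ _ XY|x X _]; first by have [] := phiP X.
    by apply/predeqP => x; rewrite -phi_f XY phi_f.
  by rewrite phi_f.
move=> g [[_ gI gS] _].
have {}gI : injective g by move=> x y; apply: gI; rewrite inE.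
have /choice[s sP] y : exists y', (forall x, f x = y -> y' = f (g x)) /\
    (~ range f y -> y' = y).
  have [[x _ <-]|ny] := pselect (range f y).
    by exists (f (g x)); split=> [x' /fI->//|[]]; exists x.
  by exists y; split=> // x fx; case: ny; exists x.
have sf x : s (f x) = f (g x) by have [e _] := sP (f x); exact: e.
have sN y : ~ range f y -> s y = y by have [_] := sP y.
have [|g' Fg' g's] := sym s.
  split=> [y Ay|y z _ _|y Ay].
  - have [[x _ <-]|/sN->//] := pselect (range f y).
    by rewrite sf; apply: fA; exists (g x).
  - have [[x _ <-]|ny] := pselect (range f y);
      have [[x' _ <-]|nz] := pselect (range f z).
    + by rewrite !sf => /fI/gI->.
    + by rewrite sf (sN z) // => fz; case: nz; exists (g x).
    + by rewrite sf (sN y) // => yf; case: ny; exists (g x').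
    + by rewrite !sN.
  - have [[x _ <-]|ny] := pselect (range f y); last by exists y => //; exact: sN.
    have [x' _ <-] := gS x I; exists (f x'); last exact: sf.
    by apply: fA; exists x'.
by exists g' => // x; rewrite g's ?sf //; apply: fA; exists x.
Qed.

Theorem theorem3p8 (T : Type) (T_infinite : infinite_set [set: T]) :
  exists (Fstar : set (set T)) (A : set T),
    homogeneous Fstar /\
    A #= [set: T] /\
    [set Y : set T | Y `<=` A] = [set X `&` A | X in Fstar] /\
    (forall s : T -> T, Sym A s ->
       exists2 g, Aut Fstar g & forall x, A x -> g x = s x) /\
    (forall f : T -> T, injective f -> range f `<=` A ->
       forall F : set (set T), induces_bi_embedding F Fstar f) /\
    bi_universal [set F : set (set T) | homogeneous F] Fstar.
Proof.
have [j jL] := tower_limit_exists T_infinite.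
have j0I : injective (j 0) := lim_inj jL (n := 0).
pose A := range (j 0).
have tr Y : Y `<=` A -> exists2 X, universal_family j X & X `&` A = Y.
  (* At level zero every subset of [T] is present, in particular the pullback of [Y] along [j 0]. *)
  move=> YA; have [y [X [yX y0]]] :=
    tracks_exists (N := 0) (fun t => `[< Y (j 0 t) >]) jL.
  exists X; first by exists 0, y.
  have XY t : X (j 0 t) <-> Y (j 0 t).
    by rewrite yX.2 // y0; split=> /asboolP.
  apply/seteqP; split=> [u [Xu [t _ tu]]|t Yt].
    by move: Xu; rewrite -tu XY.
  by have [x _ xt] := YA t Yt; rewrite -xt; split; [rewrite XY xt|exists x].
have sym s : Sym A s ->
    exists2 g, Aut (universal_family j) g & forall x, A x -> g x = s x.
  move=> [sA sI sS].
  have Aj x : A (j 0 x) by exists x.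
  have /choice[f fP] x : exists y, j 0 y = s (j 0 x).
    by have [y _ ys] := sA _ (Aj x); exists y.
  have fI : injective f.
    by move=> x y fxy; apply/j0I/sI; rewrite ?inE // -!fP fxy.
  have /choice[f' f'K] y : exists x, f x = y.
    by have [_ [x _ <-] sxy] := sS _ (Aj y); exists x; apply: j0I; rewrite fP.
  have fK : cancel f f' by move=> x; apply: fI; rewrite f'K.
  have [a af] := perm_aut (conj fK f'K).
  have [g [Fg gj _]] := aut_extends a jL.
  by exists g => // _ [x _ <-]; rewrite gj af fP.
have emb := bi_embedding_of_rich tr sym.
exists (universal_family j), A; split; first exact: universal_family_homogeneous.
split; first by apply: inj_card_eq => x y _ _; exact: j0I.
split.
  apply/seteqP; split=> [Y /tr[X FX <-]|_ [X _ <-]]; first by exists X.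
  exact: subIsetr.
(* The points of level zero are [T] itself, so [j 0] is an injection of [T] into [A]. *)
split=> //; split=> // F _; exists (j 0); exact: emb.
Qed.
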